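(* In the hat game with $n\ge 1$ prisoners and $k=2$ extra hats, a perfect deterministic strategy exists if and only if $n\le 6$.
   Context: Hat game with $n$ prisoners and $k$ extra hats: prisoners numbered $1,\dots,n$ stand in a line; there are $n+k$ hats with distinct colors $1,\dots,n+k$. The warden assigns a uniformly random injective map $\{1,\dots,n\}\to\{1,\dots,n+k\}$ (prisoner $i$ gets color $x_i$; unused hats are discarded). Prisoner $i$ sees exactly $x_{i+1},\dots,x_n$. Prisoners guess their own colors in the order $1,\dots,n$, each hearing all earlier guesses; a deterministic strategy specifies each prisoner's guess as a function of what he sees and hears, agreed in advance. They win if all guesses are correct; the success probability is the fraction of the $(n+k)!/k!$ assignments on which they win. A strategy is perfect if its success probability equals $1/(k+1)$. *)

(* Defs.v *)
From mathcomp Require Import all_boot all_order all_algebra.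

Set Implicit Arguments.
Unset Strict Implicit.
Unset Printing Implicit Defensive.

Import Order.TTheory GRing.Theory Num.Theory.
Local Open Scope ring_scope.

(* Prisoners and colours are numbered from 0: prisoner i sees the hats of the
   prisoners j > i. *)
Definition color (n k : nat) := 'I_(n + k).

Definition assignments (n k : nat) : {set {ffun 'I_n -> color n k}} :=
  [set x : {ffun 'I_n -> color n k} | injectiveb x].

Lemma card_assignments (n k : nat) :
  #|assignments n k| = ((n + k)`! %/ k`!)%N.
Proof. by rewrite card_inj_ffuns !card_ord ffact_factd ?leq_addr // addKn. Qed.

(* s i heard seen is the guess of prisoner i. Here heard lists the guesses of
   prisoners 0, ..., i - 1 and seen lists the hats of prisoners
   i + 1, ..., n - 1, both in increasing order of prisoners. The values of s i
   on sequences of other lengths are never used. *)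
Definition strategy (n k : nat) :=
  'I_n -> seq (color n k) -> seq (color n k) -> color n k.

Definition seen (n k : nat) (x : {ffun 'I_n -> color n k}) (i : 'I_n) :
    seq (color n k) :=
  [seq x j | j : 'I_n <- enum 'I_n & (i < j)%N].

Definition guesses (n k : nat) (s : strategy n k)
    (x : {ffun 'I_n -> color n k}) : seq (color n k) :=
  foldl (fun heard i => rcons heard (s i heard (seen x i))) [::] (enum 'I_n).

Definition wins (n k : nat) (s : strategy n k)
    (x : {ffun 'I_n -> color n k}) : bool :=
  guesses s x == [seq x i | i <- enum 'I_n].

Definition success_probability (n k : nat) (s : strategy n k) : rat :=
  #|[set x in assignments n k | wins s x]|%:R / #|assignments n k|%:R.

Definition perfect (n k : nat) (s : strategy n k) : Prop :=
  success_probability s = 1 / k.+1%:R.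

(* Main.v *)
Require Import Defs.
From mathcomp Require Import all_boot all_order all_algebra.

Set Implicit Arguments.
Unset Strict Implicit.
Unset Printing Implicit Defensive.

Import GRing.Theory Num.Theory.

(* Call a line the set of three assignments obtained by fixing the hats of all
   prisoners but one.  A deterministic strategy wins on at most one assignment
   of each line, so it is perfect exactly when its winning assignments form a
   tiling, a set meeting every line in one point; conversely every tiling is the
   set of wins of a perfect strategy.  Fixing the hat of prisoner 0 turns a
   tiling for n + 1 prisoners into one for n prisoners.

   Six prisoners: take the colours to be the vectors of F_2^3, so that the sum s
   of the six hats is the sum of the two unused colours.  Translation by s pairs
   up the six prisoners; keep the assignments for which this matching belongs to
   a fixed 1-factorization of K_6.  On a line through prisoner i with unused
   vectors p, q, r, prisoner i is always paired with the prisoner wearing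
   p + q + r, and the three assignments give the three matchings of the other
   four prisoners; exactly one completes the edge to a factor.

   Seven prisoners: tilings for n + 1 prisoners are families, indexed by the hat
   of prisoner 0, of pairwise disjoint tilings for n prisoners.  Enumerating
   these families from n = 1 upwards, there are few of them, and two of the
   resulting partial tilings for six prisoners are never disjoint. *)

(** * Tilings, and fixing the hat of prisoner 0 *)

Definition del (T : Type) (i : nat) (s : seq T) := take i s ++ drop i.+1 s.

Section Tiling.
Variable T : eqType.

(* Indices are off by one: [n.+1] prisoners, and [C] lists [n.+3] colours. *)
Definition tiling (n : nat) (C : seq T) (W : pred (seq T)) : Prop :=
  [/\ forall w, W w -> [/\ size w = n.+1, uniq w & {subset w <= C}],
      forall u v, size (u ++ v) = n -> uniq (u ++ v) -> {subset u ++ v <= C} ->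
        exists x, W (u ++ x :: v)
    & forall u v x y, W (u ++ x :: v) -> W (u ++ y :: v) -> x = y].

Lemma size_del i (s : seq T) : i < size s -> size (del i s) = (size s).-1.
Proof.
move=> lti; rewrite size_cat size_take lti size_drop.
by case: (size s) lti => // m; rewrite ltnS subSS => /subnKC.
Qed.

Lemma mem_del x0 i (s : seq T) x :
  uniq s -> i < size s -> (x \in del i s) = (x != nth x0 s i) && (x \in s).
Proof.
move=> us lti; have -> : del i s = rem (nth x0 s i) s by rewrite remE index_uniq.
by rewrite mem_rem_uniq.
Qed.

Lemma uniq_del i (s : seq T) : uniq s -> uniq (del i s).
Proof.
move=> us; case: (ltnP i (size s)) => [lti|ge].
  case: s us lti => // x0 s us lti.
  by have := rem_uniq (nth x0 (x0 :: s) i) us; rewrite remE index_uniq.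
by rewrite /del take_oversize // drop_oversize ?cats0 // (leq_trans ge).
Qed.

Lemma tiling_del x0 n (C : seq T) W i : uniq C -> i < size C -> tiling n.+1 C W ->
  tiling n (del i C) (fun w => W (nth x0 C i :: w)).
Proof.
move=> uC lti [val ex un]; split=> [w /val[[sw] /= /andP[nw uw] sub]|u v suv uuv sub|u v x y].
- split=> // x xw; rewrite (mem_del x0) // sub ?inE ?xw ?orbT // andbT.
  by apply: contraNneq nw => <-.
- have sub' x : x \in u ++ v -> (x != nth x0 C i) && (x \in C).
    by move/sub; rewrite (mem_del x0).
  have [|||x Wx] := ex (nth x0 C i :: u) v; last by exists x.
  + by rewrite /= suv.
  + by rewrite /= uuv andbT; apply/negP => /sub'; rewrite eqxx.
  + by move=> x; rewrite inE => /predU1P[->|/sub'/andP[]//]; apply: mem_nth.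
- exact: (un (_ :: u)).
Qed.

End Tiling.

(** * Exhaustive search excluding seven prisoners *)

(* A tree describes part of a tiling: child [a] is what is left once prisoner 0
   wears the [a]-th available colour, and the leaf is the index of the colour of
   the last prisoner among the three available ones.  Only the first four colours
   are branched on, which keeps the enumeration small and still suffices. *)
Definition child (t : GenTree.tree nat) (i : nat) :=
  if t is GenTree.Node _ ts then nth (GenTree.Leaf 0) ts i else t.
Definition leaf (t : GenTree.tree nat) := if t is GenTree.Leaf i then i else 0.

(* [all] evaluates the whole list under [vm_compute], where [andb] is strict. *)
Fixpoint lazy_all (p : nat -> bool) (s : seq nat) :=
  if s is x :: s' then if p x then lazy_all p s' else false else true.

(* [I] and [J] list the colours still available in [t] and in [u]. *)
Fixpoint disj n (I J : seq nat) (t u : GenTree.tree nat) : bool :=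
  if n is n'.+1 then
    lazy_all (fun a => lazy_all (fun b =>
      if eqn (nth 0 I a) (nth 0 J b)
      then disj n' (del a I) (del b J) (child t a) (child u b)
      else true) [:: 0; 1; 2; 3]) [:: 0; 1; 2; 3]
  else if eqn (nth 0 I (leaf t)) (nth 0 J (leaf u)) then false else true.

(** The tree [t] would become child number [size ts], so its words avoid that colour. *)
Definition compatible n (ts : seq (GenTree.tree nat)) t :=
  lazy_all (fun a => disj n (del a (iota 0 n.+4)) (del (size ts) (iota 0 n.+4))
                        (nth (GenTree.Leaf 0) ts a) t)
    (iota 0 (size ts)).

Fixpoint families n (objs : seq (GenTree.tree nat)) k :=
  if k is k'.+1 then
    flatten [seq [seq rcons ts t | t <- objs & compatible n ts t] | ts <- families n objs k']
  else [:: [::]].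

Fixpoint candidates n : seq (GenTree.tree nat) :=
  if n is n'.+1 then
    [seq GenTree.Node 0 ts | ts <- families n' (candidates n') 4]
  else [seq GenTree.Leaf i | i <- [:: 0; 1; 2]].

(** Only the words recorded by the tree must lie in [W]; [W] may contain others. *)
Fixpoint fits (T : Type) (x0 : T) n (C : seq T) (W : pred (seq T)) t : Prop :=
  if n is n'.+1 then
    forall a, a < 4 ->
      fits x0 n' (del a C) (fun w => W (nth x0 C a :: w)) (child t a)
  else leaf t < 3 /\ W [:: nth x0 C (leaf t)].

Arguments lazy_all p s : simpl never.

Lemma lazy_allE p s : lazy_all p s = all p s.
Proof. by elim: s => // x s IH; rewrite /lazy_all -/lazy_all IH. Qed.

Lemma map_del (T U : Type) (f : T -> U) i s : map f (del i s) = del i (map f s).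
Proof. by rewrite map_cat map_take map_drop. Qed.

(** If the test failed, following equal colours down both trees would reach a word common to [W] and
    [V]. *)
Lemma fits_disj (T : Type) (x0 : T) (f : nat -> T) n I J W V t u :
  size I = n.+3 -> size J = n.+3 ->
  fits x0 n (map f I) W t -> fits x0 n (map f J) V u ->
  (forall w, W w -> V w -> False) -> disj n I J t u.
Proof.
elim: n I J W V t u => [|n IH] I J W V t u sI sJ /=.
  move=> [lt Wt] [lu Vu] WV; case: ifP => // /eqnP eqIJ; exfalso.
  apply: (WV _ Wt); move: Vu.
  by rewrite !(nth_map 0) ?sI ?sJ // eqIJ.
move=> Ht Hu WV; rewrite lazy_allE; apply/allP => a a4.
rewrite lazy_allE; apply/allP => b b4.
have {}a4 : a < 4 by rewrite (mem_iota 0 4) in a4.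
have {}b4 : b < 4 by rewrite (mem_iota 0 4) in b4.
case: ifP => // /eqnP eqIJ.
have lt4 k : k < 4 -> k < n.+4 by move/leq_trans; apply.
move: (Ht a a4) (Hu b b4); rewrite -!map_del => Hta Hub.
apply: IH Hta Hub _; rewrite ?size_del ?sI ?sJ ?lt4 //.
by move=> w; rewrite !(nth_map 0) ?sI ?sJ ?lt4 // eqIJ; apply: WV.
Qed.

(** Uniqueness on the lines of prisoner 0 makes the tilings left by different hats disjoint, so the
    search keeps the trees that induction finds in them. *)
Lemma candidates_complete (T : eqType) (x0 : T) n (C : seq T) W :
  uniq C -> size C = n.+3 -> tiling n C W ->
  exists2 t, t \in candidates n & fits x0 n C W t.
Proof.
elim: n C W => [|n IH] C W uC sC tW.
  have [_ /(_ [::] [::])[]// x Wx _] := tW.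
  have [/(_ _ Wx)[_ _ /(_ x)] xC _ _] := tW.
  have {}xC: x \in C by apply: xC; rewrite inE.
  have lx : index x C < 3 by rewrite -sC index_mem.
  exists (GenTree.Leaf (index x C)).
    by case: (index x C) lx => [|[|[]]].
  by split=> //=; rewrite nth_index.
have ltC k : k < 4 -> k < size C by rewrite sC; move/leq_trans; apply.
have tree a : a < 4 -> exists2 t, t \in candidates n
    & fits x0 n (del a C) (fun w => W (nth x0 C a :: w)) t.
  move=> a4; apply: IH; rewrite ?uniq_del ?size_del ?ltC ?sC //.
  by apply: tiling_del => //; apply: ltC.
(* Naming colours by their position in [C] lets one computation on numbers serve every [C]. *)
have CE : C = map (nth x0 C) (iota 0 n.+4) by rewrite -sC map_nth_iota0 ?take_size.
suff /(_ 4 isT)[ts ts_fam [sts ts_fit]] : forall k, k <= 4 ->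
    exists2 ts, ts \in families n (candidates n) k
    & size ts = k /\ forall a, a < k -> fits x0 n (del a C)
        (fun w => W (nth x0 C a :: w)) (nth (GenTree.Leaf 0) ts a).
  by exists (GenTree.Node 0 ts); first exact: map_f.
elim=> [|k IHk] k4; first by exists [::].
have [ts ts_fam [sts ts_fit]] := IHk (ltnW k4).
have [t t_cand t_fit] := tree k k4.
exists (rcons ts t); last first.
  split=> [|a]; rewrite ?size_rcons ?sts // nth_rcons sts ltnS leq_eqVlt.
  by case/predU1P => [->|lt_ak]; rewrite ?ltnn ?eqxx // lt_ak; apply: ts_fit.
apply/flattenP; exists [seq rcons ts t' | t' <- candidates n & compatible n ts t'].
  exact: map_f.
rewrite map_f // mem_filter t_cand andbT /compatible lazy_allE.
apply/allP => a; rewrite mem_iota sts /= => lt_ak.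
have a4 := leq_ltn_trans (ltnW lt_ak) k4.
have size4 b : b < 4 -> size (del b (iota 0 n.+4)) = n.+3.
  by move=> b4; rewrite size_del size_iota // -sC ltC.
have fitE b : map (nth x0 C) (del b (iota 0 n.+4)) = del b C by rewrite map_del -CE.
apply: (@fits_disj _ x0 (nth x0 C)); rewrite ?size4 ?fitE //.
- exact: ts_fit.
- exact: t_fit.
- move=> w Wa Wk; have [_ _ un] := tW.
  have /eqP := un [::] w _ _ Wa Wk.
  by rewrite nth_uniq ?ltC // ltn_eqF.
Qed.

Lemma candidates6_nil : candidates 6 = [::].
Proof. by vm_compute. Qed.

Lemma no_tiling7 (T : eqType) (C : seq T) W :
  uniq C -> size C = 9 -> ~ tiling 6 C W.
Proof.
case: C => // x0 C uC sC /(candidates_complete x0 uC sC)[t].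
by rewrite candidates6_nil.
Qed.

(** Fixing hats one at a time leaves only six and seven prisoners to be treated. *)
Lemma tiling_leq (T : eqType) m n (C : seq T) W :
  m <= n -> uniq C -> size C = n.+3 -> tiling n C W ->
  exists (C' : seq T) (W' : pred (seq T)), [/\ uniq C', size C' = m.+3 & tiling m C' W'].
Proof.
move/subnK <-; elim: (n - m) C W => [|d IH] C W uC sC tW; first by exists C, W.
have lt0 : 0 < size C by rewrite sC.
have x0 : T by case: C lt0 {uC sC tW} => // x0.
by apply: IH (tiling_del x0 uC lt0 tW); rewrite ?uniq_del ?size_del ?sC.
Qed.

(** * Construction for six prisoners over F_2^3 *)

Definition vec3 : eqType := (bool * bool * bool)%type.

Definition add3 (x y : vec3) : vec3 :=
  let: (a, b, c) := x in let: (a', b', c') := y in (a (+) a', b (+) b', c (+) c').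

Definition cube : seq vec3 :=
  [seq (ab.1, ab.2, c) | ab <- [seq (a, b) | a <- [:: false; true], b <- [:: false; true]],
                         c <- [:: false; true]].

(* The k-th factor pairs prisoner 5 with prisoner k, and prisoners k + j and
   k - j modulo 5 for j = 1, 2; as the six hats add up to [s], the pair j = 2
   need not be tested. *)
Definition factor_word (w : seq vec3) : bool :=
  let o := (false, false, false) in
  let s := foldr add3 o w in
  has (fun k => (add3 s (nth o w k) == nth o w 5)
             && (add3 s (nth o w (k.+1 %% 5)) == nth o w ((k + 4) %% 5)))
    (iota 0 5).

Fixpoint all_arr (T : eqType) k (C : seq T) (p : seq T -> seq T -> bool) : bool :=
  if k is k'.+1 then all (fun c => all_arr k' (rem c C) (fun v => p (c :: v))) C
  else p [::] C.

Lemma all_arrP (T : eqType) k (C : seq T) p v :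
  all_arr k C p -> size v = k -> uniq C -> uniq v -> {subset v <= C} ->
  exists R, [/\ p v R, uniq R & forall x, (x \in R) = (x \notin v) && (x \in C)].
Proof.
elim: k C p v => [|k IH] C p [|c v] //= pC; first by exists C.
case=> sv uC /andP[cv uv] vC.
have cC : c \in C by apply: vC; rewrite mem_head.
have [x xv|R [pR uR RE]] := IH _ _ _ (allP pC c cC) sv (rem_uniq c uC) uv.
  by rewrite mem_rem_uniq // inE vC ?inE ?xv ?orbT // andbT; apply: contraNneq cv => <-.
by exists R; split=> // x; rewrite RE mem_rem_uniq // !inE negb_or andbA (andbC (x \notin v)).
Qed.

(** All lines are checked: [v] holds the five fixed hats, [R] the three vectors left and [i] the
    place of the free prisoner. *)
Lemma factor_lines :
  all_arr 5 cube (fun v R =>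
    all (fun i => count (fun x => factor_word (take i v ++ x :: drop i v)) R == 1) (iota 0 6)).
Proof. by vm_compute. Qed.

Lemma uniq_mid (T : eqType) (u v : seq T) x :
  uniq (u ++ x :: v) = (x \notin u ++ v) && uniq (u ++ v).
Proof. by rewrite -cat1s uniq_catCA /=. Qed.

Lemma size_mid (T : Type) (u v : seq T) x : size (u ++ x :: v) = (size (u ++ v)).+1.
Proof. by rewrite !size_cat addnS. Qed.

Lemma cube_tiling :
  tiling 5 cube (fun w => [&& size w == 6, uniq w & factor_word w]).
Proof.
have cubeE x : x \in cube by case: x => [[[] []] []].
have line u v : size (u ++ v) = 5 -> uniq (u ++ v) ->
    exists R : seq vec3, [/\ uniq R, forall x, (x \in R) = (x \notin u ++ v)
      & count (fun x => factor_word (u ++ x :: v)) R = 1].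
  move=> suv uuv.
  have [//|R [pR uR RE]] := all_arrP factor_lines suv isT uuv.
  exists R; split=> // [x|]; first by rewrite RE cubeE andbT.
  have /(allP pR) : size u \in iota 0 6.
    by rewrite mem_iota ltnS -suv size_cat leq_addr.
  by rewrite take_size_cat // drop_size_cat // => /eqP.
split=> [w /and3P[/eqP sw uw _]|u v suv uuv _|u v x y]; first by split=> // x _.
  have [R [uR RE cR]] := line u v suv uuv.
  have /hasP[x xR Wx] : has (fun x => factor_word (u ++ x :: v)) R by rewrite has_count cR.
  exists x; rewrite Wx uniq_mid -RE xR uuv andbT.
  by rewrite size_mid suv.
rewrite !uniq_mid => /and3P[/eqP suv /andP[xuv uuv] Wx] /and3P[_ /andP[yuv _] Wy].
have [|R [uR RE cR]] := line u v _ uuv.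
  by move: suv; rewrite size_mid => -[].
move: cR; rewrite -size_filter.
set F := filter _ _; have xF : x \in F by rewrite mem_filter Wx RE.
have yF : y \in F by rewrite mem_filter Wy RE.
by case: F xF yF => [|z []] //; rewrite !inE => /eqP -> /eqP ->.
Qed.

(** * Passing between strategies and tilings *)

Lemma guesses_correct (I C : eqType) (g : I -> seq C -> C) (x : I -> C) e :
  foldl (fun heard i => rcons heard (g i heard)) [::] e = map x e <->
  forall e1 i e2, e = e1 ++ i :: e2 -> g i (map x e1) = x i.
Proof.
elim/last_ind: e => [|e z [IH1 IH2]]; first by split=> // _ [].
rewrite foldl_rcons map_rcons; split=> [/rcons_inj[eqF eqz] e1 i e2|H].
  case/lastP: e2 => [|e2 y]; last first.
    by rewrite -rcons_cons -rcons_cat => /rcons_inj[/(IH1 eqF)].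
  by rewrite cats1 => /rcons_inj[<- <-]; rewrite -{1}eqF.
have /IH2 -> : forall e1 i e2, e = e1 ++ i :: e2 -> g i (map x e1) = x i.
  by move=> e1 i e2 E; apply: (H e1 i (rcons e2 z)); rewrite E rcons_cat.
by rewrite (H e z [::]) // cats1.
Qed.

Section Strategy.
Variable m : nat.
Implicit Types (s : strategy m.+1 2) (i : 'I_m.+1).
Notation hats := {ffun 'I_m.+1 -> color m.+1 2}.

Definition word (x : hats) : seq (color m.+1 2) := [seq x i | i <- enum 'I_m.+1].

Lemma size_word x : size (word x) = m.+1.
Proof. by rewrite size_map size_enum_ord. Qed.

Lemma nth_word c x (i : 'I_m.+1) : nth c (word x) i = x i.
Proof. by rewrite (nth_map i) ?size_enum_ord // nth_ord_enum. Qed.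

Lemma word_ffun c w : size w = m.+1 -> word [ffun i : 'I_m.+1 => nth c w i] = w.
Proof.
move=> sw; apply: (@eq_from_nth _ c) => [|k]; rewrite size_word ?sw // => km.
by rewrite (nth_word c _ (Ordinal km)) ffunE.
Qed.

Lemma uniq_word x : uniq (word x) = injectiveb x.
Proof.
apply/idP/injectiveP => [ux i j eq_ij|inj]; last by rewrite map_inj_uniq ?enum_uniq.
apply/val_inj/eqP; rewrite /= -(nth_uniq (x i) _ _ ux) ?size_word //.
by rewrite !nth_word eq_ij.
Qed.

Lemma seenE (x : hats) i : seen x i = drop i.+1 (word x).
Proof.
rewrite /seen /word -map_drop; congr map; apply: (inj_map val_inj).
rewrite map_drop val_enum_ord drop_iota add0n.
rewrite -(filter_map val (fun j => i < j)) val_enum_ord.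
have -> : iota 0 m.+1 = iota 0 i.+1 ++ iota i.+1 (m.+1 - i.+1).
  by rewrite -iotaD subnKC.
rewrite filter_cat.
rewrite (eq_in_filter (a2 := pred0)) => [|j]; last first.
  by rewrite mem_iota add0n ltnS ltnNge => /andP[_ ->].
rewrite filter_pred0; apply/all_filterP/allP => j.
by rewrite mem_iota => /andP[].
Qed.

Lemma winsP s x :
  reflect (forall i, s i (take i (word x)) (drop i.+1 (word x)) = x i) (wins s x).
Proof.
have enumE (i : 'I_m.+1) :
    enum 'I_m.+1 = take i (enum 'I_m.+1) ++ i :: drop i.+1 (enum 'I_m.+1).
  by rewrite -{2}(nth_ord_enum i i) -drop_nth ?size_enum_ord // cat_take_drop.
have [W1 W2] := guesses_correct (fun i heard => s i heard (seen x i)) x (enum 'I_m.+1).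
apply: (iffP eqP) => [/W1 H i|H].
  by rewrite -map_take -seenE; apply: H (enumE i).
apply: W2 => e1 i e2 E; rewrite seenE -[RHS]H; congr (s i _ _).
rewrite /word E map_cat take_size_cat // size_map.
have := index_enum_ord i; rewrite E index_cat /= eqxx addn0.
by have := enum_uniq 'I_m.+1; rewrite E uniq_mid mem_cat negb_or => /andP[/andP[/negPf ->]].
Qed.

Definition others (i : 'I_m.+1) (x : hats) : {ffun 'I_m -> color m.+1 2} :=
  [ffun j => x (lift i j)].

Definition winning s := [set x in assignments m.+1 2 | wins s x].
Definition part_assignments := [set y : {ffun 'I_m -> color m.+1 2} | injectiveb y].

Lemma card_part_assignments : #|part_assignments| = (m.+3 ^_ m)%N.
Proof. by rewrite card_inj_ffuns !card_ord addn2. Qed.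

(** The lines of one prisoner are counted by [part_assignments] and hold three assignments each. *)
Lemma perfectE s : perfect s <-> #|winning s| = #|part_assignments|.
Proof.
have card_A : #|assignments m.+1 2| = (#|part_assignments| * 3)%N.
  by rewrite card_part_assignments card_inj_ffuns !card_ord addn2 ffactnSr -addn3 addKn.
have B_neq0 : (#|part_assignments|%:R != 0 :> rat)%R.
  by rewrite card_part_assignments pnatr_eq0 -lt0n ffact_gt0 -addn3 leq_addr.
rewrite /perfect /success_probability -/(winning s) card_A natrM invfM mulrA.
split=> [/(mulIf _) H|->]; last by rewrite divff.
apply/eqP; rewrite -(eqr_nat rat); apply/eqP.
by rewrite -[LHS](divfK B_neq0) H ?mul1r // invr_eq0 pnatr_eq0.
Qed.

Lemma others_sub i s x : x \in winning s -> others i x \in part_assignments.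
Proof.
rewrite !inE => /andP[/injectiveP inj_x _]; apply/injectiveP => j k.
by rewrite !ffunE => /inj_x /lift_inj.
Qed.

(** On two wins that differ at most at [i], prisoner [i] hears and sees the same, hence makes the
    same correct guess. *)
Lemma others_inj i s : {in winning s &, injective (others i)}.
Proof.
move=> x y; rewrite !inE => /andP[_ /winsP wx] /andP[_ /winsP wy] /ffunP eq_xy.
have eq_lift j : x (lift i j) = y (lift i j) by have := eq_xy j; rewrite !ffunE.
have eq_nth k c : k != i :> nat -> nth c (word x) k = nth c (word y) k.
  move=> ki; have [km|?] := ltnP k m.+1; last by rewrite !nth_default ?size_word.
  rewrite !(nth_word c _ (Ordinal km)); case: (unliftP i (Ordinal km)) => [j ->|] //.
  by move/(congr1 val) => /= E; rewrite E eqxx in ki.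
have eq_i : x i = y i.
  rewrite -wx -wy; congr (s i _ _); apply: (@eq_from_nth _ (x i)).
  - by rewrite !size_take !size_word.
  - move=> k; rewrite size_take size_word ltn_ord => ki.
    by rewrite !nth_take // eq_nth // ltn_eqF.
  - by rewrite !size_drop !size_word.
  - by move=> k _; rewrite !nth_drop eq_nth // gtn_eqF // leq_addr.
by apply/ffunP => j; case: (unliftP i j) => [k ->|->].
Qed.

Lemma perfect_others s i : perfect s <-> others i @: winning s = part_assignments.
Proof.
have card_im := card_in_imset (@others_inj i s).
split=> [/perfectE eq_card|eq_im]; last by apply/perfectE; rewrite -card_im eq_im.
apply/eqP; rewrite eqEcard card_im eq_card leqnn andbT.
by apply/subsetP => _ /imsetP[x /others_sub ? ->].
Qed.

Lemma nth_insert (T : Type) (c x : T) u v k :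
  nth c (u ++ x :: v) (bump (size u) k) = nth c (u ++ v) k.
Proof.
rewrite !nth_cat /bump; case: (leqP (size u) k) => [le_uk|lt_ku]; last by rewrite add0n lt_ku.
by rewrite add1n ltnNge (leqW le_uk) /= subSn.
Qed.

Lemma perfect_tiling s : perfect s ->
  exists W, tiling m (enum (color m.+1 2)) W.
Proof.
move=> perf_s; pose c0 : color m.+1 2 := ord0.
exists (fun w => [exists x in winning s, w == word x]); split.
- move=> w /existsP[x /andP[]]; rewrite !inE => /andP[inj_x _] /eqP ->.
  by rewrite size_word uniq_word; split=> // c _; rewrite mem_enum.
- move=> u v suv uuv _; have lt_u : size u < m.+1.
    by have := leq_addr (size v) (size u); rewrite -size_cat suv.
  pose i := Ordinal lt_u; have /(perfect_others s i) imE := perf_s.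
  have : [ffun j : 'I_m => nth c0 (u ++ v) j] \in part_assignments.
    rewrite inE; apply/injectiveP => j k /eqP.
    by rewrite !ffunE nth_uniq ?suv // => /eqP/val_inj.
  rewrite -imE => /imsetP[x win_x /ffunP eq_x].
  exists (x i); apply/existsP; exists x; rewrite win_x /=.
  have sw : size (u ++ x i :: v) = m.+1 by rewrite size_mid suv.
  rewrite -(word_ffun c0 sw); apply/eqP; congr word; apply/ffunP => j.
  rewrite ffunE; case: (unliftP i j) => [k|] ->.
    by rewrite nth_insert; have := eq_x k; rewrite !ffunE.
  by rewrite nth_cat ltnn subnn.
- move=> u v x y /existsP[f /andP[]]; rewrite inE => /andP[_ /winsP win_f] /eqP wf.
  case/existsP=> g /andP[]; rewrite inE => /andP[_ /winsP win_g] /eqP wg.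
  have lt_u : size u < m.+1.
    have : size u < size (word f) by rewrite -wf size_mid size_cat ltnS leq_addr.
    by rewrite size_word.
  pose i := Ordinal lt_u.
  have := win_f i; have := win_g i.
  rewrite -!(nth_word c0) -wf -wg /= !nth_cat !ltnn !subnn /= !take_size_cat //.
  by rewrite -!cat_rcons !drop_size_cat ?size_rcons // => -> ->.
Qed.

Lemma tiling_perfect (T : eqType) (C : seq T) W :
  uniq C -> size C = m.+3 -> tiling m C W -> exists s : strategy m.+1 2, perfect s.
Proof.
move=> uC sC [val ex un].
have x0 : T by case: C sC {uC val ex un} => // x0.
pose f (c : color m.+1 2) := nth x0 C c.
have sC' : size C = m.+1 + 2 by rewrite sC addn2.
have f_inj : injective f.
  by move=> c d /eqP; rewrite nth_uniq ?sC' // => /eqP/val_inj.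
have f_mem c : f c \in C by rewrite mem_nth ?sC'.
have f_surj x : x \in C -> exists c, x = f c.
  move=> xC; have lt_x : index x C < m.+1 + 2 by rewrite -sC' index_mem.
  by exists (Ordinal lt_x); rewrite /f nth_index.
(* Trusting the guesses heard, each prisoner completes the word to one in [W]; [ord0] is a mere
   default. *)
pose s : strategy m.+1 2 := fun i heard rest =>
  odflt ord0 [pick c | W (map f (heard ++ c :: rest))].
have winW x : W (map f (word x)) -> x \in winning s.
  move=> Wx; have [_ uw _] := val _ Wx.
  rewrite !inE -uniq_word (map_uniq uw); apply/winsP => i; rewrite /s.
  have wE : word x = take i (word x) ++ x i :: drop i.+1 (word x).
    by rewrite -(nth_word ord0) -drop_nth ?size_word // cat_take_drop.
  case: pickP => [c /=|/(_ (x i))]; last by rewrite -wE Wx.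
  by move: Wx; rewrite {1}wE !map_cat /= => Wx /(un _ _ _ _ Wx)/f_inj.
(* By counting, it is enough to win on every line of prisoner 0. *)
exists s; apply/(perfect_others s ord0)/eqP; rewrite eqEsubset; apply/andP; split.
  by apply/subsetP => _ /imsetP[x /others_sub ? ->].
apply/subsetP => y; rewrite inE => /injectiveP inj_y.
pose v := [seq f (y j) | j <- enum 'I_m].
have [||_ /mapP[j _ ->]|x Wx] := ex [::] v => //=.
- by rewrite size_map size_enum_ord.
- by rewrite map_inj_uniq ?enum_uniq // => j k /f_inj/inj_y.
have [_ _ /(_ x (mem_head _ _))/f_surj[c xE]] := val _ Wx.
pose z : hats := [ffun i => if unlift ord0 i is Some j then y j else c].
apply/imsetP; exists z.
  apply: winW; rewrite (_ : map f _ = x :: v) //.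
  rewrite /word enum_ordSl /= ffunE unlift_none -xE -2!map_comp.
  by congr cons; apply: eq_map => j /=; rewrite ffunE liftK.
by apply/ffunP => j; rewrite !ffunE liftK.
Qed.

End Strategy.

Theorem theorem2 (n : nat) (hn : (1 <= n)%N) :
  (exists s : strategy n 2, perfect s) <-> (n <= 6)%N.
Proof.
case: n hn => // m _; split=> [[s /perfect_tiling[W tW]]|le_m5].
  rewrite ltnNge; apply/negP => le6m.
  have sC : size (enum (color m.+1 2)) = m.+3 by rewrite size_enum_ord addn2.
  have [C' [W' [uC' sC' tW']]] := tiling_leq le6m (enum_uniq _) sC tW.
  exact: no_tiling7 uC' sC' tW'.
have [C' [W' [uC' sC' tW']]] :=
  tiling_leq (le_m5 : m <= 5) (isT : uniq cube) (erefl : size cube = 8) cube_tiling.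
exact: tiling_perfect uC' sC' tW'.
Qed.
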